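(* Let $R$ be a potent $\Delta U$ ring and let $\bar R=R/J(R)$. Then: (1) For any $\bar e=\bar e^2\in\bar R$ and any $\bar u_1,\bar u_2\in U(\bar e\bar R\bar e)$, $\bar u_1+\bar u_2\neq\bar e$. (2) There does not exist $\bar e=\bar e^2\in\bar R$ such that $\bar e\bar R\bar e\cong M_2(S)$ for some ring $S$.
   Context: Rings are associative with identity, not necessarily commutative. $U(R)$ is the group of units of $R$ and $J(R)$ the Jacobson radical. $\Delta(R)=\{r\in R : r+U(R)\subseteq U(R)\}$. A ring $R$ is called $\Delta U$ if $U(R)=1+\Delta(R)$. A ring $R$ is semi-potent if every one-sided ideal not contained in $J(R)$ contains a nonzero idempotent; a semi-potent ring is potent if idempotents lift modulo $J(R)$. For an idempotent $e$ of a ring $R$, $eRe$ is regarded as a ring with identity $e$, and $U(eRe)$ is its unit group. $M_2(S)$ is the ring of $2\times 2$ matrices over $S$.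
   Formalization: In (1) the idempotent ē is assumed nonzero, and in (2) the ring S is assumed nonzero: for ē = 0 the corner is the zero ring, where 0 is a unit and 0 + 0 = ē, and it is isomorphic to M₂(0). *)

(* Defs.v *)
From HB Require Import structures.
From mathcomp Require Import all_boot all_algebra.
From mathcomp Require Import all_classical.

Set Implicit Arguments.
Unset Strict Implicit.
Unset Printing Implicit Defensive.

Import GRing.Theory.
Local Open Scope ring_scope.
Local Open Scope quotient_scope.
Local Open Scope classical_set_scope.

Section RingNotions.
Variable R : pzRingType.
Implicit Types (I M : set R) (e r u x : R).

(* U(R). MathComp's GRing.unit is not available: a pzRingType carries no
   chosen inverse operation. *)
Definition units : set R := [set u | exists v, u * v = 1 /\ v * u = 1].

Definition Delta : set R := [set r | forall u, units u -> units (r + u)].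

Definition DeltaU_ring : Prop := units = [set 1 + r | r in Delta].

(* Closure under opposites follows, by multiplying by -1. *)
Definition left_ideal I : Prop :=
  [/\ I 0, forall x y, I x -> I y -> I (x + y)
    & forall a x, I x -> I (a * x)].

Definition right_ideal I : Prop :=
  [/\ I 0, forall x y, I x -> I y -> I (x + y)
    & forall a x, I x -> I (x * a)].

Definition maximal_left_ideal M : Prop :=
  [/\ left_ideal M, M <> setT
    & forall I, left_ideal I -> M `<=` I -> I = M \/ I = setT].

Definition jacobson : set R :=
  [set x | forall M, maximal_left_ideal M -> M x].

(* The boolean form of [jacobson], from which the quotient is built. *)
Definition jacobson_pred : {pred R} := fun x => x \in jacobson.

Lemma jacobson_predP x : reflect (jacobson x) (x \in jacobson_pred).
Proof. by apply: (iffP idP) => [/set_mem|/mem_set]. Qed.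

Lemma jacobson_zmod_closed : zmod_closed jacobson_pred.
Proof.
split; first by apply/jacobson_predP => M [[M0 _ _] _ _].
move=> x y /jacobson_predP Jx /jacobson_predP Jy.
apply/jacobson_predP => M maxM; have [[_ MD MM] _ _] := maxM.
by rewrite -mulN1r; apply: MD; [exact: Jx | exact/MM/(Jy M)].
Qed.

HB.instance Definition _ :=
  GRing.isZmodClosed.Build R jacobson_pred jacobson_zmod_closed.

Lemma jacobson_mull a x : jacobson x -> jacobson (a * x).
Proof. by move=> Jx M maxM; have [[_ _ MM] _ _] := maxM; exact/MM/(Jx M). Qed.

(* If M is a maximal left ideal not containing a, then so is (M : a). *)
Lemma jacobson_mulr a x : jacobson x -> jacobson (x * a).
Proof.
move=> Jx M maxM; have [[M0 MD MM] MnT Mmax] := maxM.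
case: (pselect (M a)) => [Ma|nMa]; first exact: MM.
apply: (Jx [set y | M (y * a)]); split.
- split=> [|y z /= My Mz|b y /= My] /=; first by rewrite mul0r.
  + by rewrite mulrDl; apply: MD.
  + by rewrite -mulrA; apply: MM.
- by move=> /seteqP[_ /(_ 1 I)]; rewrite /= mul1r.
- move=> I [I0 ID IM] MI.
  case: (pselect (I `<=` [set y | M (y * a)])) => [IsM|nIM].
    by left; apply/seteqP.
  right; have [c [Ic nMc]] : exists c, I c /\ ~ M (c * a).
    by apply: contrapT => /forallNP h; apply: nIM => c Ic;
       apply: contrapT => nMc; apply: (h c).
  pose K : set R := [set z | exists b m, M m /\ z = b * (c * a) + m].
  have idK : left_ideal K.
    split=> [|y z [b [m [Mm ->]]] [b' [m' [Mm' ->]]]|d y [b [m [Mm ->]]]].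
    + by exists 0, 0; rewrite mul0r addr0.
    + exists (b + b'), (m + m'); split; first exact: MD.
      by rewrite mulrDl addrACA.
    + exists (d * b), (d * m); split; first exact: MM.
      by rewrite mulrDr mulrA.
  have MK : M `<=` K by move=> m Mm; exists 0, m; rewrite mul0r add0r.
  have [KM|KT] := Mmax K idK MK.
    by case: nMc; rewrite -KM; exists 1, 0; rewrite mul1r addr0.
  have [b [m [Mm ab]]] : K a by rewrite KT.
  apply/seteqP; split=> // y _.
  rewrite -[y]mulr1; apply: (IM); rewrite -(subrK (b * c) 1).
  apply: ID; last exact: IM.
  by apply: MI; rewrite /= mulrBl mul1r -mulrA {1}ab addrAC subrr add0r.
Qed.

End RingNotions.

Arguments jacobson R : clear implicits.
Arguments jacobson_pred R : clear implicits.
Arguments units R : clear implicits.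
Arguments Delta R : clear implicits.
Arguments DeltaU_ring R : clear implicits.

(* R / J(R). MathComp only equips Quotient.quot with a multiplication when the base
   ring is commutative; here it is built from jacobson being two-sided. *)
Definition jquot (R : pzRingType) : Type := Quotient.quot (jacobson_pred R).

Section JacobsonQuotient.
Variable R : pzRingType.
Local Notation Q := (jquot R).

HB.instance Definition _ := GRing.Zmodule.on Q.
HB.instance Definition _ := EqQuotient.on Q.
HB.instance Definition _ := ZmodQuotient.on Q.

Lemma jquot_eqP (x y : R) :
  reflect (\pi_Q x = \pi_Q y) (x - y \in jacobson_pred R).
Proof. by rewrite Quotient.idealrBE; apply: eqP. Qed.

Definition jquot_one : Q := \pi_Q 1.
Definition jquot_mul : Q -> Q -> Q := lift_op2 Q *%R.

Lemma pi_jquot_mul (x y : R) :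
  jquot_mul (\pi_Q x) (\pi_Q y) = \pi_Q (x * y).
Proof.
unlock jquot_mul; apply/jquot_eqP; set x' := repr _; set y' := repr _.
have Jx : jacobson R (x' - x).
  by apply/jacobson_predP/jquot_eqP; rewrite reprK.
have Jy : jacobson R (y' - y).
  by apply/jacobson_predP/jquot_eqP; rewrite reprK.
rewrite -(subrK (x * y') (x' * y')) -addrA -mulrBl -mulrBr rpredD //.
  by apply/jacobson_predP; exact: jacobson_mulr Jx.
by apply/jacobson_predP; exact: jacobson_mull Jy.
Qed.

Lemma jquot_mulA : associative jquot_mul.
Proof.
by move=> x y z; rewrite -[x]reprK -[y]reprK -[z]reprK !pi_jquot_mul mulrA.
Qed.

Lemma jquot_mul1l : left_id jquot_one jquot_mul.
Proof. by move=> x; rewrite -[x]reprK pi_jquot_mul mul1r. Qed.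

Lemma jquot_mul1r : right_id jquot_one jquot_mul.
Proof. by move=> x; rewrite -[x]reprK pi_jquot_mul mulr1. Qed.

Lemma jquot_mulDl : left_distributive jquot_mul +%R.
Proof.
move=> x y z; rewrite -[x]reprK -[y]reprK -[z]reprK.
by rewrite -raddfD !pi_jquot_mul -raddfD mulrDl.
Qed.

Lemma jquot_mulDr : right_distributive jquot_mul +%R.
Proof.
move=> x y z; rewrite -[x]reprK -[y]reprK -[z]reprK.
by rewrite -raddfD !pi_jquot_mul -raddfD mulrDr.
Qed.

HB.instance Definition _ := GRing.Zmodule_isPzRing.Build Q
  jquot_mulA jquot_mul1l jquot_mul1r jquot_mulDl jquot_mulDr.

Definition jpi (x : R) : Q := \pi_Q x.

Lemma jpi_is_zmod_morphism : zmod_morphism jpi.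
Proof. by move=> x y; rewrite /jpi raddfB. Qed.

Lemma jpi_is_monoid_morphism : monoid_morphism jpi.
Proof. by split=> // x y; rewrite /jpi -pi_jquot_mul. Qed.

HB.instance Definition _ :=
  GRing.isZmodMorphism.Build R Q jpi jpi_is_zmod_morphism.
HB.instance Definition _ :=
  GRing.isMonoidMorphism.Build R Q jpi jpi_is_monoid_morphism.

End JacobsonQuotient.

Section Potent.
Variable R : pzRingType.

Definition semipotent : Prop :=
  forall I : set R, left_ideal I \/ right_ideal I -> ~ (I `<=` jacobson R) ->
    exists e, [/\ I e, e * e = e & e <> 0].

Definition idempotents_lift_mod_jacobson : Prop :=
  forall f : jquot R, f * f = f -> exists e : R, e * e = e /\ jpi e = f.

Definition potent : Prop := semipotent /\ idempotents_lift_mod_jacobson.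

End Potent.

Arguments semipotent R : clear implicits.
Arguments idempotents_lift_mod_jacobson R : clear implicits.
Arguments potent R : clear implicits.

Definition corner_pred (R : pzRingType) (e : R) : {pred R} :=
  fun x => e * x * e == x.

(* The corner ring eRe: for e idempotent, eRe = {x | exe = x}. *)
Record corner (R : pzRingType) (e : R) (idem_e : e * e = e) := Corner {
  corner_val : R;
  corner_valP : corner_val \in corner_pred e
}.

Section CornerRing.
Variables (R : pzRingType) (e : R) (idem_e : e * e = e).
Local Notation C := (corner idem_e).

Lemma cornerP (x : R) :
  reflect (exists y, x = e * y * e) (x \in corner_pred e).
Proof.
apply: (iffP eqP) => [<-|[y ->]]; first by exists x.
by rewrite !mulrA idem_e -mulrA idem_e.
Qed.

Lemma corner_zmod_closed : zmod_closed (corner_pred e).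
Proof.
split=> [|x y /eqP xC /eqP yC]; first by apply/eqP; rewrite mulr0 mul0r.
by apply/eqP; rewrite mulrBr mulrBl xC yC.
Qed.

HB.instance Definition _ :=
  GRing.isZmodClosed.Build R (corner_pred e) corner_zmod_closed.
HB.instance Definition _ := [isSub for @corner_val R e idem_e].
HB.instance Definition _ := [Choice of C by <:].
HB.instance Definition _ := [SubChoice_isSubZmodule of C by <:].

Lemma corner_mull (x : C) : e * val x = val x.
Proof. by have /cornerP[y ->] := valP x; rewrite !mulrA idem_e. Qed.

Lemma corner_mulr (x : C) : val x * e = val x.
Proof. by have /cornerP[y ->] := valP x; rewrite -mulrA idem_e. Qed.

Lemma corner_one_subproof : e \in corner_pred e.
Proof. by apply/eqP; rewrite idem_e idem_e. Qed.

Lemma corner_mul_subproof (x y : C) : val x * val y \in corner_pred e.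
Proof. by apply/eqP; rewrite mulrA corner_mull -mulrA corner_mulr. Qed.

Definition corner_one : C := Corner idem_e corner_one_subproof.
Definition corner_mul (x y : C) : C := Corner idem_e (corner_mul_subproof x y).

Lemma corner_mulA : associative corner_mul.
Proof. by move=> x y z; apply: val_inj; rewrite /= mulrA. Qed.

Lemma corner_mul1l : left_id corner_one corner_mul.
Proof. by move=> x; apply: val_inj; apply: corner_mull. Qed.

Lemma corner_mul1r : right_id corner_one corner_mul.
Proof. by move=> x; apply: val_inj; apply: corner_mulr. Qed.

Lemma corner_mulDl : left_distributive corner_mul +%R.
Proof. by move=> x y z; apply: val_inj; rewrite /= mulrDl. Qed.

Lemma corner_mulDr : right_distributive corner_mul +%R.
Proof. by move=> x y z; apply: val_inj; rewrite /= mulrDr. Qed.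

HB.instance Definition _ := GRing.Zmodule_isPzRing.Build C
  corner_mulA corner_mul1l corner_mul1r corner_mulDl corner_mulDr.

End CornerRing.

Definition ring_isomorphic (A B : pzRingType) : Prop :=
  exists f : {rmorphism A -> B}, bijective f.

(* Main.v *)
(* Units lift along R -> R/J(R), so Q = R/J(R) is again a Delta-U ring. If
   u1 + u2 = e with u1, u2 units of eQe, then u1 + (1 - e) is a unit of Q, so
   -u2 = (u1 + (1 - e)) - 1 lies in Delta(Q). Adding it to the unit u2 + (1 - e)
   makes the idempotent 1 - e a unit, whence e = 0. A matrix ring M_2(S) is
   excluded because its Fibonacci matrix x satisfies x * (x - 1) = 1, so that
   x and 1 - x are units with sum 1. *)
Require Import Defs.
From HB Require Import structures.
From mathcomp Require Import all_boot all_algebra.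
From mathcomp Require Import all_classical.

Set Implicit Arguments.
Unset Strict Implicit.
Unset Printing Implicit Defensive.

Import GRing.Theory.
Local Open Scope ring_scope.

Section Units.
Variable R : pzRingType.
Implicit Types (x y u v : R) (L M : set R).

Lemma left_ideal_subset_maximal L : left_ideal L -> ~ L 1 ->
  exists M, maximal_left_ideal M /\ (L `<=` M)%classic.
Proof.
move=> idL nL1.
(* The union with L makes the empty chain harmless in Zorn's lemma. *)
pose P A := left_ideal (L `|` A)%classic /\ ~ (L `|` A)%classic 1.
have [|A [[idA nA1] maxA]] := @Zorn_bigcup _ P.
  move=> F FP totF; split; last first.
    by move=> [//|[A FA A1]]; have [_] := FP _ FA; apply; right.
  have [L0 LD LM] := idL; split; first by left.
  - move=> x y [Lx|[A FA Ax]] [Ly|[B FB By]].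
    + by left; apply: LD.
    + have [[_ BD _] _] := FP _ FB.
      by have [|Bxy] := BD x y (or_introl Lx) (or_intror By);
        [left | right; exists B].
    + have [[_ AD _] _] := FP _ FA.
      by have [|Axy] := AD x y (or_intror Ax) (or_introl Ly);
        [left | right; exists A].
    + have [C [FC Cx Cy]] : exists C, [/\ F C, C x & C y].
        by have [AB|BA] := totF _ _ FA FB;
          [exists B; split=> //; exact: AB | exists A; split=> //; exact: BA].
      have [[_ CD _] _] := FP _ FC.
      by have [|Cxy] := CD x y (or_intror Cx) (or_intror Cy);
        [left | right; exists C].
  - move=> a x [Lx|[A FA Ax]]; first by left; apply: LM.
    have [[_ _ AM] _] := FP _ FA.
    by have [|Aax] := AM a x (or_intror Ax); [left | right; exists A].
exists (L `|` A)%classic; split; last by move=> x; left.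
split=> // [AT|I idI AI]; first by apply: nA1; rewrite AT.
case: (pselect (I 1)) => [I1|nI1].
  right; apply/seteqP; split=> // x _; rewrite -[x]mulr1.
  by have [_ _ IM] := idI; apply: IM.
left; apply/seteqP; split=> // x Ix; right; apply: contrapT => nAx.
have LI : (L `|` I)%classic = I.
  by apply/seteqP; split=> y; [case=> // Ly; apply: AI; left | right].
apply: (maxA I); last by rewrite /P LI.
by split=> [y Ay|IA]; [apply: AI; right | exact/nAx/IA].
Qed.

(** Otherwise [R(1 + x)] lies in a maximal left ideal; that ideal also contains [x], hence [1]. *)
Lemma jacobson_left_inverse x : jacobson R x -> exists c, c * (1 + x) = 1.
Proof.
move=> Jx; apply: contrapT => ninv.
pose L : set R := [set y | exists c, y = c * (1 + x)]%classic.
have idL : left_ideal L.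
  split=> [|_ _ [b ->] [c ->]|a _ [b ->]]; first by exists 0; rewrite mul0r.
  - by exists (b + c); rewrite mulrDl.
  - by exists (a * b); rewrite mulrA.
have [|M [maxM LM]] := left_ideal_subset_maximal idL.
  by move=> [c c1]; apply: ninv; exists c.
have [[M0 MD MM] MnT _] := maxM; apply: MnT; apply/seteqP; split=> // y _.
have M1 : M 1.
  rewrite -(addrK x 1) -mulN1r; apply: MD; last exact/MM/(Jx M).
  by apply: LM; exists 1; rewrite mul1r.
by rewrite -[y]mulr1; apply: MM.
Qed.

(** The left inverse [c] equals [1 - c * x], again [1] plus a radical element, so it has a left
    inverse [d]; then [d = d * c * (1 + x) = 1 + x]. *)
Lemma units_jacobson x : jacobson R x -> units R (1 + x).
Proof.
move=> Jx; have [c c1] := jacobson_left_inverse Jx.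
have /jacobson_left_inverse[d d1] := jacobson_mull (- c) Jx.
have cE : 1 + - c * x = c by rewrite -{1}c1 mulrDr mulr1 mulNr addrK.
rewrite cE in d1; have dE : d = 1 + x.
  by rewrite -[d]mulr1 -{1}c1 mulrA d1 mul1r.
by exists c; rewrite -{1}dE.
Qed.

(** The right inverse [v * a] and the left inverse [b * v] of [u] agree:
    [v * a = b * v * u * v * a = b * v]. *)
Lemma units_of_products u v : units R (u * v) -> units R (v * u) -> units R u.
Proof.
move=> [a [uva _]] [b [_ bvu]]; exists (v * a); split; first by rewrite mulrA.
have -> : v * a = b * v; last by rewrite -mulrA.
by rewrite -[v * a]mul1r -bvu -mulrA [v * u * _]mulrA -[v * u * v]mulrA
           -[v * _ * a]mulrA uva mulr1.
Qed.

Lemma jpi_eq1_units x : jpi x = 1 -> units R x.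
Proof.
move=> x1; rewrite -(subrKC 1 x); apply: units_jacobson.
by apply/jacobson_predP/jquot_eqP.
Qed.

(** Representatives of [q] and of its inverse multiply, in either order, to an element congruent to
    [1] modulo the radical, hence to a unit. *)
Lemma jquot_units_lift (q : jquot R) : units (jquot R) q ->
  exists u, units R u /\ jpi u = q.
Proof.
move=> [p [qp pq]]; have qE : jpi (repr q) = q := reprK q.
have pE : jpi (repr p) = p := reprK p.
exists (repr q); split=> //; apply: (@units_of_products _ (repr p));
  by apply: jpi_eq1_units; rewrite rmorphM /= qE pE.
Qed.

Lemma units_jpi u : units R u -> units (jquot R) (jpi u).
Proof. by move=> [v [uv vu]]; exists (jpi v); rewrite -!rmorphM uv vu rmorph1. Qed.

Lemma Delta_jpi r : Delta R r -> Delta (jquot R) (jpi r).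
Proof.
move=> Dr _ /jquot_units_lift[u [Uu <-]]; rewrite -rmorphD.
exact/units_jpi/Dr.
Qed.

Lemma jquot_units_subr1 (q : jquot R) : DeltaU_ring R ->
  units (jquot R) q -> Delta (jquot R) (q - 1).
Proof.
move=> RDU /jquot_units_lift[u []]; rewrite RDU => -[r Dr <-] <-.
by rewrite rmorphD rmorph1 addrC addrA addNr add0r; apply: Delta_jpi.
Qed.

(** Since [e] and [1 - e] are orthogonal, such sums multiply componentwise, so [val v + (1 - e)] is
    the inverse when [v] inverts [u]. *)
Lemma corner_units_compl (e : R) (idem_e : e * e = e) (u : corner idem_e) :
  units (corner idem_e) u -> units R (val u + (1 - e)).
Proof.
move=> [v [/(congr1 val)/= uv /(congr1 val)/= vu]].
have mulE (a b : corner idem_e) :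
    (val a + (1 - e)) * (val b + (1 - e)) = val a * val b + (1 - e).
  rewrite mulrDl !mulrDr !mulrN !mulrBl !mulr1 !mul1r.
  by rewrite corner_mulr corner_mull idem_e !subrr subr0 addr0 add0r.
by exists (val v + (1 - e)); rewrite !mulE uv vu subrKC.
Qed.

Lemma units_idem u : units R u -> u * u = u -> u = 1.
Proof. by move=> [v [uv _]] uu; rewrite -[u]mulr1 -uv mulrA uu. Qed.

End Units.

Lemma units_mul_subr1 (R : pzRingType) (x : R) : x * (x - 1) = 1 ->
  units R x /\ units R (1 - x).
Proof.
have xC : (x - 1) * x = x * (x - 1) by rewrite mulrBl mulrBr mul1r mulr1.
move=> x1; split; first by exists (x - 1); rewrite xC.
by exists (- x); rewrite -(opprB x) !mulrNN xC.
Qed.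

Lemma matrix2_mul_subr1 (S : nzRingType) :
  exists A : 'M[S]_2, A * (A - 1) = 1.
Proof.
(* Indices start at 0: the rows are [(1, 1)] and [(1, 0)]. *)
exists (\matrix_(i, j) (~~ ((i == 1) && (j == 1)))%:R).
apply/matrixP => i j; rewrite !mxE !big_ord_recl big_ord0 !mxE /=.
by case: i => -[|[]] // ?; case: j => -[|[]] // ?;
  rewrite /= ?(mulr0, mulr1, mul0r, mul1r, subr0, sub0r, subrr, addr0, add0r).
Qed.

(** The case [e = 0] is a genuine exception: in the zero corner [0] is a unit and [0 + 0 = 0]. *)
Lemma jquot_corner_units_add (R : pzRingType) (e : jquot R)
    (idem_e : e * e = e) (u1 u2 : corner idem_e) :
  DeltaU_ring R -> e <> 0 -> units (corner idem_e) u1 ->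
  units (corner idem_e) u2 -> val u1 + val u2 <> e.
Proof.
move=> RDU e0 /corner_units_compl/(jquot_units_subr1 RDU) D1.
move=> /corner_units_compl/D1 + u12.
have -> : val u1 + (1 - e) - 1 + (val u2 + (1 - e)) = 1 - e.
  rewrite addrA [_ - 1 + val u2]addrAC [_ + (1 - e) + val u2]addrAC.
  by rewrite u12 subrKC subrr add0r.
(* The idempotent [1 - e] is now a unit, so it equals [1]. *)
move=> /units_idem Ue; apply: e0; apply: oppr_inj; apply: (addrI 1).
rewrite oppr0 addr0; apply: Ue.
by rewrite mulrBl mul1r mulrBr mulr1 idem_e subrr subr0.
Qed.

Theorem proposition2p4 (R : pzRingType) (R_potent : potent R)
    (R_DeltaU : DeltaU_ring R) :
  (forall (e : jquot R) (idem_e : e * e = e), e <> 0 ->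
     forall u1 u2 : corner idem_e,
       units (corner idem_e) u1 -> units (corner idem_e) u2 ->
       val u1 + val u2 <> e) /\
  ~ (exists (e : jquot R) (idem_e : e * e = e) (S : nzRingType),
       ring_isomorphic (corner idem_e) 'M[S]_2).
Proof.
split=> [e idem_e e0 u1 u2|[e [idem_e [S [f [g fK gK]]]]]].
  exact: jquot_corner_units_add.
have [A A1] := matrix2_mul_subr1 S.
have [Ux Uy] : units _ (g A) /\ units _ (1 - g A).
  (* Only [f] is known to be a morphism, so the identity for [g A] is checked after applying [f]. *)
  apply: units_mul_subr1; apply: (can_inj fK).
  by rewrite rmorphM rmorphB rmorph1 gK.
(* If [e = 0], then [1 = 0] in the corner, and [f] carries this to the nonzero ring ['M[S]_2]. *)
have e0 : e <> 0.
  move=> e0; have /eqP := oner_neq0 'M[S]_2; apply.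
  rewrite -(rmorph1 f) -(rmorph0 f); congr (f _); exact: val_inj.
by apply: (jquot_corner_units_add R_DeltaU e0 Ux Uy); rewrite -raddfD subrKC.
Qed.
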